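(* For every finite Coxeter type $P$, the skew-growth function $N_{G^{dual +}_{P}}(t)$ has exactly $\mathrm{rank}(P)$ simple roots on the interval $(0,1]$, one of which is $t=1$.
   Context: The finite (irreducible) Coxeter types are $A_l$ ($l\ge1$), $B_l$ ($l\ge2$), $D_l$ ($l\ge4$), $E_6,E_7,E_8,F_4,G_2,H_3,H_4$ and $I_2(p)$ ($p\ge3$), with rank equal to the subscript ($2$ for $I_2(p)$). For such $P$ with Coxeter system $(W,S)$, set of reflections $T$, reflection length $\ell_T$, order $g\le_T h\iff \ell_T(g)+\ell_T(g^{-1}h)=\ell_T(h)$, and bipartite Coxeter element $c$, the dual Artin monoid $G^{dual+}_P$ is the monoid generated by $T$ with relations $r\cdot s=(rsr^{-1})\cdot r$ for all $r,s\in T$ with $rs\le_T c$; it is graded by word length $\deg$ and is a lattice for left divisibility. Its skew-growth function is $N_{G^{dual+}_P}(t)=\sum_{J\subseteq T}(-1)^{|J|}t^{\deg(\mathrm{lcm}(J))}$. It is known that these polynomials are: $N_{A_l}=\sum_{k=0}^{l} (-1)^{k}\frac{1}{l}\binom {l}{k}\binom {l+k}{k+1}t^k$; $N_{B_l}=\sum_{k=0}^{l} (-1)^{k}\binom {l}{k}\binom {l+k-1}{k}t^k$; $N_{D_l}=\sum_{k=0}^{l} (-1)^{k} \big( \binom {l}{k}\binom {l+k-2}{k} + \binom {l-2}{k-2}\binom {l+k-3}{k}\big) t^k$; $N_{E_6}=1 - 36 t + 300 t^2 - 1035 t^3 + 1720 t^4 - 1368 t^5 + 418 t^6$; $N_{E_7}=1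 - 63 t + 777 t^2 - 3927 t^3 + 9933 t^4 - 13299 t^5 + 9009 t^6 - 2431t^7$; $N_{E_8}=1 - 120 t + 2135 t^2 - 15120 t^3 + 54327 t^4 - 108360 t^5 + 121555 t^6 - 71760 t^7 + 17342 t^8$; $N_{F_4}=1 - 24 t + 101 t^2 - 144 t^3 + 66 t^4$; $N_{G_2}=1 - 6 t + 5 t^2$; $N_{H_3}=1 - 15 t + 35 t^2 - 21 t^3$; $N_{H_4}=1 - 60 t + 307 t^2 - 480 t^3 + 232 t^4$; $N_{I_2(p)}=1 - p t + (p-1) t^2$. *)

(* Defs.v *)
From mathcomp Require Import all_boot all_order all_algebra all_fingroup.
From mathcomp Require Import classical_sets.

Set Implicit Arguments.
Unset Strict Implicit.
Unset Printing Implicit Defensive.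

Import GRing.Theory.

(* The constructors take arbitrary naturals; [finite_type] below restores the
   ranges l >= 1, l >= 2, l >= 4 and p >= 3. *)
Inductive coxeter_type : Type :=
| TypeA of nat
| TypeB of nat
| TypeD of nat
| TypeE6
| TypeE7
| TypeE8
| TypeF4
| TypeG2
| TypeH3
| TypeH4
| TypeI2 of nat.

Definition finite_type (P : coxeter_type) : bool :=
  match P with
  | TypeA l => 1 <= l
  | TypeB l => 2 <= l
  | TypeD l => 4 <= l
  | TypeI2 p => 3 <= p
  | _ => true
  end.

Definition rank (P : coxeter_type) : nat :=
  match P with
  | TypeA l | TypeB l | TypeD l => l
  | TypeE6 => 6
  | TypeE7 => 7
  | TypeE8 => 8
  | TypeF4 | TypeH4 => 4
  | TypeH3 => 3
  | TypeG2 | TypeI2 _ => 2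
  end.

(* Coxeter diagrams, vertices numbered from 0; [bond P i j] is the order of
   s_i s_j for i < j.  The diagram of [fork_bond n k] is the path
   0 - 1 - ... - (n-2) together with the vertex n-1 attached to the vertex k. *)
Definition fork_bond (n k i j : nat) : nat :=
  if (j.+1 < n) && (j == i.+1) || (j.+1 == n) && (i == k) then 3 else 2.

Definition bond (P : coxeter_type) (i j : nat) : nat :=
  match P with
  | TypeA _ => if j == i.+1 then 3 else 2
  | TypeB l => if j == i.+1 then (if j.+1 == l then 4 else 3) else 2
  | TypeD l => fork_bond l (l - 3) i j
  | TypeE6 => fork_bond 6 2 i j
  | TypeE7 => fork_bond 7 2 i j
  | TypeE8 => fork_bond 8 2 i j
  | TypeF4 => if j == i.+1 then (if i == 1 then 4 else 3) else 2
  | TypeG2 => 6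
  | TypeH3 | TypeH4 => if j == i.+1 then (if i == 0 then 5 else 3) else 2
  | TypeI2 p => p
  end.

Definition coxeter_matrix (P : coxeter_type) (i j : nat) : nat :=
  if i == j then 1 else bond P (minn i j) (maxn i j).

(* The monoid < A | rel > is represented by words over A up to the congruence
   of the free monoid [seq A] generated by [rel]. *)
Inductive word_congr (A : Type) (rel : seq A -> seq A -> Prop) :
  seq A -> seq A -> Prop :=
| WordCongrRel u v x y :
    rel x y -> word_congr rel (u ++ x ++ v) (u ++ y ++ v)
| WordCongrRefl x : word_congr rel x x
| WordCongrSym x y : word_congr rel x y -> word_congr rel y x
| WordCongrTrans x y z :
    word_congr rel x y -> word_congr rel y z -> word_congr rel x z.

(* (s_i s_j)^m(i,j) = 1.  The case i = j is s_i^2 = 1, so the monoid presented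
   by these relations is the group presented by them. *)
Definition coxeter_rel (P : coxeter_type) (x y : seq 'I_(rank P)) : Prop :=
  exists i j : 'I_(rank P),
    x = flatten (nseq (coxeter_matrix P i j) [:: i; j]) /\ y = [::].

Section CoxeterSystem.

Local Open Scope group_scope.

Variable gT : finGroupType.

(* Here W is the whole group [gT] and S is the family [s]; the second clause says
   that the relations of [coxeter_rel] present W. *)
Definition coxeter_system (P : coxeter_type) (s : 'I_(rank P) -> gT) : Prop :=
  (<<[set s i | i : 'I_(rank P)]>> = [set: gT]) /\
  (forall u v : seq 'I_(rank P),
    \prod_(i <- u) s i = \prod_(i <- v) s i <-> word_congr (@coxeter_rel P) u v).

(* A 2-colouring [I], [~: I] of the Coxeter diagram. *)
Definition bipartition (P : coxeter_type) (I : {set 'I_(rank P)}) : Prop :=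
  forall i j : 'I_(rank P),
    i != j -> (i \in I) = (j \in I) -> coxeter_matrix P i j = 2.

(* When [bipartition P I] holds, the factors of each of the two products
   commute. *)
Definition coxeter_element n (s : 'I_n -> gT) (I : {set 'I_n}) : gT :=
  (\prod_(i in I) s i) * (\prod_(i in ~: I) s i).

Variables (n : nat) (s : 'I_n -> gT).

Definition reflections : {set gT} :=
  [set s i ^ x | i in [set: 'I_n], x in [set: gT]].

(* [reflections ^+ k] is the set of products of k reflections.  The search
   stops at #|gT|, which bounds the length as soon as the reflections
   generate. *)
Definition reflection_length (g : gT) : nat :=
  find (fun k => g \in reflections ^+ k) (iota 0 #|gT|.+1).

Definition absolute_le (g h : gT) : bool :=
  (reflection_length g + reflection_length (g^-1 * h) == reflection_length h)%N.

Definition reflection : finType := {r : gT | r \in reflections}.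

Definition dual_rel (c : gT) (x y : seq reflection) : Prop :=
  exists r t q : reflection,
    [/\ absolute_le (val r * val t) c,
        val q = val r * val t * (val r)^-1,
        x = [:: r; t] & y = [:: q; r]].

(* The dual Artin monoid is the set of words in the reflections up to
   [dual_congr c]; its product is concatenation. *)
Definition dual_congr (c : gT) : seq reflection -> seq reflection -> Prop :=
  word_congr (dual_rel c).

Definition dual_dvd (c : gT) (x y : seq reflection) : Prop :=
  exists z, dual_congr c (x ++ z) y.

Definition is_dual_lcm (c : gT) (J : {set reflection}) (x : seq reflection) :
    Prop :=
  (forall r, r \in J -> dual_dvd c [:: r] x) /\
  (forall y, (forall r, r \in J -> dual_dvd c [:: r] y) -> dual_dvd c x y).

(* A word representing lcm(J).  The dual Artin monoid of a finite type is a
   lattice, so the default value is not used there.  [dual_rel] preserves the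
   length of words, so deg(lcm(J)) is the size of any such word. *)
Definition dual_lcm (c : gT) (J : {set reflection}) : seq reflection :=
  xget [::] (is_dual_lcm c J).

Definition skew_growth (R : nzRingType) (c : gT) : {poly R} :=
  (\sum_(J : {set reflection}) (-1) ^+ #|J| *: 'X^(size (dual_lcm c J)))%R.

End CoxeterSystem.

Section Formulas.

Local Open Scope ring_scope.

(* In type D, 'C(l-2, k-2) is 0 for k < 2, whereas truncated subtraction would
   give 'C(l - 2, 0) = 1. *)
Definition skew_growth_formula (R : fieldType) (P : coxeter_type) : {poly R} :=
  match P with
  | TypeA l =>
      \sum_(k < l.+1)
        ((-1) ^+ k * (l%:R^-1 * ('C(l, k) * 'C(l + k, k.+1))%:R)) *: 'X^k
  | TypeB l =>
      \sum_(k < l.+1) ((-1) ^+ k * ('C(l, k) * 'C(l + k - 1, k))%:R) *: 'X^k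
  | TypeD l =>
      \sum_(k < l.+1)
        ((-1) ^+ k *
         ('C(l, k) * 'C(l + k - 2, k) +
          (if (2 <= k)%N then 'C(l - 2, k - 2) * 'C(l + k - 3, k) else 0))%:R)
        *: 'X^k
  | TypeE6 =>
      Poly [:: 1; - 36%:R; 300%:R; - 1035%:R; 1720%:R; - 1368%:R; 418%:R]
  | TypeE7 =>
      Poly [:: 1; - 63%:R; 777%:R; - 3927%:R; 9933%:R; - 13299%:R; 9009%:R;
               - 2431%:R]
  | TypeE8 =>
      Poly [:: 1; - 120%:R; 2135%:R; - 15120%:R; 54327%:R; - 108360%:R;
               121555%:R; - 71760%:R; 17342%:R]
  | TypeF4 => Poly [:: 1; - 24%:R; 101%:R; - 144%:R; 66%:R]
  | TypeG2 => Poly [:: 1; - 6%:R; 5%:R]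
  | TypeH3 => Poly [:: 1; - 15%:R; 35%:R; - 21%:R]
  | TypeH4 => Poly [:: 1; - 60%:R; 307%:R; - 480%:R; 232%:R]
  | TypeI2 p => Poly [:: 1; - p%:R; (p - 1)%:R]
  end.

End Formulas.

(* Main.v *)
(* With q_n the Jacobi polynomials P_n^(0,1) transported to [0, 1] and
   normalised by q_n(0) = 1, comparing coefficients gives
     N_(B_(n+1)) = (1 - t) q_n,
     (2n + 3) t N_(A_(n+1)) = (1 - t) (q_n - q_(n+1)),
     N_(D_(n+3)) = (1 - t) ((1 + w - v t) q_(n+1) - w q_n)  for some v, w > 0.
   The three-term recurrence of the q_n yields Sturm interlacing: q_(n+1) has
   n + 1 roots in (0, 1), at which q_n alternates in sign.  Hence so do the
   other two cofactors of 1 - t, and the intermediate value theorem (using also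
   the ends 0 and 1 in type D) produces rank - 1 roots in (0, 1).  Together with
   t = 1 they exhaust the degree, so all the roots are simple.  The exceptional
   types are settled by sign changes at rational points, and the polynomials of
   I_2(p) and G_2 = I_2(6) factor. *)
Require Import Defs.
From mathcomp Require Import all_boot all_order all_algebra all_fingroup.
From mathcomp Require Import reals polyrcf ring lra zify.

Set Implicit Arguments.
Unset Strict Implicit.
Unset Printing Implicit Defensive.

Import Order.TTheory GRing.Theory Num.Theory.

Local Open Scope ring_scope.

(** * Sign changes and interlacing *)

Section RealRoots.

Variable R : rcfType.
Implicit Types (p q f : {poly R}) (r : nat -> R).

Definition has_simple_roots01 p n :=
  exists rs : seq R,
    [/\ uniq rs, size rs = n,
        (forall x : R, (x \in rs) = ((0 < x <= 1) && root p x)),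
        (forall x : R, x \in rs -> mup x p = 1%N) &
        1 \in rs].

(** Distinct roots divide out jointly, and the size bound leaves only a nonzero constant as
    cofactor. *)
Lemma prod_XsubC_of_roots p (rs : seq R) :
    p != 0 -> (size p <= (size rs).+1)%N -> uniq rs -> all (root p) rs ->
  exists2 c : R, c != 0 & p = c *: \prod_(z <- rs) ('X - z%:P).
Proof.
move=> p0 sp; rewrite -uniq_rootsE => urs rrs.
have [q pE] := uniq_roots_prod_XsubC rrs urs.
have prod0 : \prod_(z <- rs) ('X - z%:P) != 0 :> {poly R}.
  exact: monic_neq0 (monic_prod_XsubC _ _ _).
have q0 : q != 0 by apply: contraNneq p0 => q0; rewrite pE q0 mul0r.
have /size_poly1P [c c0 qE] : size q == 1%N.
  move: sp; rewrite {1}pE size_mul // size_prod_XsubC addnS /= -add1n leq_add2r.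
  by rewrite eqn_leq size_poly_gt0 q0 => ->.
by exists c => //; rewrite pE qE mul_polyC.
Qed.

(** A product of distinct linear factors has no further root, and each multiplicity in it is 1. *)
Lemma all_roots_in01 p (rs : seq R) :
    p != 0 -> (size p <= (size rs).+1)%N -> uniq rs -> all (root p) rs ->
    {in rs, forall x, 0 < x <= 1} -> 1 \in rs ->
  has_simple_roots01 p (size rs).
Proof.
move=> p0 sp urs rrs rs01 rs1.
have [c c0 pE] := prod_XsubC_of_roots p0 sp urs rrs.
have rootE x : root p x = (x \in rs).
  by rewrite pE rootZ // root_prod_XsubC.
exists rs; split=> // [x|x xrs].
- by rewrite rootE andbC; apply/idP/andP => [xrs|[]//]; split=> //; apply: rs01.
- by rewrite pE -mul_polyC mupMr ?rootC // mu_prod_XsubC count_uniq_mem // xrs.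
Qed.

Lemma interior_roots_in01 p (y : nat -> R) n :
    p != 0 -> (size p <= n.+2)%N -> root p 1 ->
    (forall i, (i < n)%N -> 0 < y i < 1 /\ root p (y i)) ->
    (forall i, (i.+1 < n)%N -> y i < y i.+1) ->
  has_simple_roots01 p n.+1.
Proof.
move=> p0 sp p1 yP y_lt.
have szE : size (rcons (mkseq y n) 1) = n.+1 by rewrite size_rcons size_mkseq.
have in_mkseq z : z \in mkseq y n -> 0 < z < 1 /\ root p z.
  by case/mapP=> i; rewrite mem_iota => /= /yP yi ->.
rewrite -szE; apply: all_roots_in01; rewrite ?szE //.
- rewrite rcons_uniq; apply/andP; split.
    by apply/negP => /in_mkseq [/andP[_]]; rewrite ltxx.
  apply: (lt_sorted_uniq (T := R)); apply/(sortedP 0) => i.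
  by rewrite size_mkseq => lt_i; rewrite !nth_mkseq ?y_lt // ltnW.
- by rewrite all_rcons p1; apply/allP => z /in_mkseq [].
- move=> z; rewrite mem_rcons inE.
  case/orP=> [/eqP->|/in_mkseq [/andP[-> /ltW->]] //].
  by rewrite ltr01 lexx.
- by rewrite mem_rcons mem_head.
Qed.

Lemma alternating_roots p (x : nat -> R) n :
    (forall i, (i < n)%N -> x i < x i.+1) ->
    (forall i, (i <= n)%N -> 0 < (-1) ^+ i * p.[x i]) ->
  exists y, forall i, (i < n)%N -> x i < y i < x i.+1 /\ root p (y i).
Proof.
move=> x_lt px.
have ex (i : 'I_n) : exists z, x i < z < x i.+1 /\ root p z.
  have sgn : p.[x i] * p.[x i.+1] < 0.
    have := mulr_gt0 (px i (ltnW (ltn_ord i))) (px i.+1 (ltn_ord i)).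
    by rewrite exprS mulN1r mulNr mulrN mulrACA -expr2 sqrr_sign mul1r oppr_gt0.
  have [z] := poly_ivtoo (ltW (x_lt i (ltn_ord i))) sgn.
  by rewrite in_itv /=; exists z.
have {ex} [y yP] := fin_all_exists ex.
(* The finite choice lives on ['I_n]; the value 0 only extends it to indices about which nothing is
   claimed. *)
exists (fun i => if insub i is Some j then y j else 0) => i lt_in.
by rewrite insubT; apply: (yP (Ordinal lt_in)).
Qed.

(** Consecutive [y i] are separated by the node [x i.+1], so they increase, and the bounds on the
    end nodes confine them to the open interval (0, 1). *)
Lemma interior_nodes_roots f (x y : nat -> R) n :
    f != 0 -> (size f <= n.+2)%N -> root f 1 -> 0 <= x 0%N -> x n <= 1 ->
    (forall i, (i < n)%N -> x i < x i.+1) ->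
    (forall i, (i < n)%N -> x i < y i < x i.+1 /\ root f (y i)) ->
  has_simple_roots01 f n.+1.
Proof.
move=> f0 sf f1 x0 xn x_lt yP.
have x_ge0 i : (i <= n)%N -> 0 <= x i.
  elim: i => // i IHi lt_in.
  by apply: (le_trans (IHi (ltnW lt_in))); apply/ltW/x_lt.
(* Descending induction from the last node, hence the index [n - i]. *)
have x_le1 i : (i <= n)%N -> x (n - i)%N <= 1.
  elim: i => [|i IHi lt_in]; first by rewrite subn0.
  apply: le_trans (IHi (ltnW lt_in)); rewrite -(subnSK lt_in).
  by apply/ltW/x_lt; rewrite ltn_subrL /=; case: (n) lt_in.
apply: (interior_roots_in01 (y := y)) => // i lt_in.
- have [/andP[lt1 lt2] ->] := yP i lt_in; split=> //; apply/andP; split.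
    exact: le_lt_trans (x_ge0 i (ltnW lt_in)) lt1.
  by apply: (lt_le_trans lt2); rewrite -(subKn lt_in) x_le1 // leq_subr.
- have [/andP[_ lt1] _] := yP i (ltnW lt_in).
  by have [/andP[lt2 _] _] := yP i.+1 lt_in; apply: lt_trans lt2.
Qed.

(* The interior nodes r 1, ..., r n are the roots of [p]; the alternation of
   [q] at them is the interlacing of the roots of [p] and [q]. *)
Definition sturm_nodes p q n r :=
  [/\ r 0%N = 0, r n.+1 = 1, forall i, (i <= n)%N -> r i < r i.+1 &
      forall i, (i < n)%N -> root p (r i.+1) /\ 0 < (-1) ^+ i * q.[r i.+1]].

Lemma sturm_nodes_lt p q n r i j :
  sturm_nodes p q n r -> (i < j <= n.+1)%N -> r i < r j.
Proof.
move=> [_ _ r_lt _]; elim: j => // j IHj /andP[].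
rewrite ltnS leq_eqVlt => /orP[/eqP-> lt_jn|lt_ij lt_jn]; first exact: r_lt.
by apply: (@lt_trans _ _ (r j)); [apply: IHj; rewrite lt_ij ltnW | apply: r_lt].
Qed.

(** The interior nodes are all the roots of [p]. Passing from 0 to [x] crosses exactly [i] of them,
    and each crossing flips one linear factor, so p(x) p(0) has the sign of (-1)^i. *)
Lemma sturm_nodes_sign p q n r i (x : R) :
    sturm_nodes p q n r -> (size p <= n.+1)%N -> 0 < p.[0] ->
    (i <= n)%N -> r i < x < r i.+1 ->
  0 < (-1) ^+ i * p.[x].
Proof.
move=> nodes sp p_gt0 le_in /andP[lt_rx lt_xr].
have [r0 _ _ rP] := nodes; have lt_r := sturm_nodes_lt nodes.
pose rs := mkseq (r \o S) n.
have urs : uniq rs.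
  apply: (lt_sorted_uniq (T := R)); apply/(sortedP 0) => j.
  rewrite size_mkseq => lt_j; rewrite !nth_mkseq //=; last exact: ltnW.
  by apply: lt_r; lia.
have rrs : all (root p) rs.
  by apply/allP => z /mapP[j]; rewrite mem_iota /= => /rP[+ _] ->.
have p0 : p != 0 by apply: contraTneq p_gt0 => ->; rewrite horner0 ltxx.
have szE : size rs = n by rewrite size_mkseq.
have [|c c0 pE] := prod_XsubC_of_roots p0 _ urs rrs; first by rewrite szE.
have hornerE z : p.[z] = c * \prod_(j < n) (z - r j.+1).
  rewrite pE hornerZ horner_prod big_map.
  have -> : iota 0 n = index_iota 0 n by rewrite /index_iota subn0.
  rewrite big_mkord; congr (_ * _).
  by apply: eq_bigr => j _; rewrite hornerXsubC.
rewrite -(pmulr_lgt0 _ p_gt0) [p.[x]]hornerE [p.[0]]hornerE.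
(* The sign becomes a product with a factor -1 for each [j < i], so that positivity can be checked
   factor by factor. *)
rewrite -{1}[i]card_ord -prodr_const (big_ord_widen n (fun=> -1)) // big_mkcond.
have -> (s a b : R) : s * (c * a) * (c * b) = c ^+ 2 * (s * a * b) by ring.
rewrite -!big_split.
apply: mulr_gt0; first by rewrite exprn_even_gt0.
apply: prodr_gt0 => j _ /=.
have rj : 0 < r j.+1 by rewrite -r0; apply: lt_r; have := ltn_ord j; lia.
rewrite sub0r mulrN -mulNr pmulr_lgt0 //; case: ifP => lt_ji.
  rewrite mulN1r opprK subr_gt0; apply: le_lt_trans lt_rx.
  move: lt_ji; rewrite leq_eqVlt => /orP[/eqP->//|lt_ji].
  by apply/ltW/lt_r; lia.
rewrite mul1r opprB subr_gt0; apply: (lt_le_trans lt_xr).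
move/negbT: lt_ji; rewrite -leqNgt leq_eqVlt => /orP[/eqP->//|lt_ij].
by apply/ltW/lt_r; have := ltn_ord j; lia.
Qed.

(** At the roots of [p] the sign of [f] is opposite to that of [q]. With the prescribed signs at 0
    and 1, [f] alternates along all the nodes. *)
Lemma sturm_nodes_alternating p q f n r :
    sturm_nodes p q n r -> 0 < f.[0] -> 0 < (-1) ^+ n.+1 * f.[1] ->
    (forall i, (i < n)%N -> f.[r i.+1] * q.[r i.+1] < 0) ->
  exists y, forall i, (i < n.+1)%N -> r i < y i < r i.+1 /\ root f (y i).
Proof.
move=> [r0 r1 r_lt rP] f0 f1 fq; apply: alternating_roots => //.
case=> [|i]; first by rewrite r0 mul1r.
rewrite ltnS leq_eqVlt => /orP[/eqP->|lt_in]; first by rewrite r1.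
have [_ q_gt0] := rP i lt_in.
rewrite exprS mulN1r mulNr oppr_gt0 -(pmulr_llt0 _ q_gt0) mulrACA -expr2.
by rewrite sqrr_sign mul1r fq.
Qed.

(** The induction step of the Sturm argument: the roots found for [f] become the interior nodes, and
    [sturm_nodes_sign] gives the alternation of [p] at them. *)
Lemma sturm_nodes_step p q f n r :
    sturm_nodes p q n r -> (size p <= n.+1)%N -> 0 < p.[0] ->
    0 < f.[0] -> 0 < (-1) ^+ n.+1 * f.[1] ->
    (forall i, (i < n)%N -> f.[r i.+1] * q.[r i.+1] < 0) ->
  exists r', sturm_nodes f p n.+1 r'.
Proof.
move=> nodes sp p0 f0 f1 fq.
have [y yP] := sturm_nodes_alternating nodes f0 f1 fq.
have [r0 r1 r_lt rP] := nodes.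
(* Node 0 is 0, node [j.+1] is the root [y j], and the first index past the roots receives 1. *)
exists (fun i => if i is j.+1 then if (j < n.+1)%N then y j else 1 else 0).
split=> //; first by rewrite ltnn.
- case=> [|i]; first by have [/andP[+ _] _] := yP 0%N isT; rewrite r0.
  rewrite ltnS => le_in; rewrite le_in.
  have [/andP[_ lt_y] _] := yP i le_in.
  case: ifP => [lt_in|/negbT]; first by
    have [/andP[+ _] _] := yP i.+1 lt_in; apply: lt_trans.
  rewrite -leqNgt ltnS => le_ni.
  have Ei : i = n by apply/eqP; rewrite eqn_leq le_in.
  by move: lt_y; rewrite Ei r1.
- move=> i lt_in; rewrite lt_in; have [yi ->] := yP i lt_in; split=> //.
  exact: sturm_nodes_sign nodes sp p0 lt_in yi.
Qed.

End RealRoots.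

(** * Jacobi polynomials and type B *)

Lemma natr_fact_neq0 (R : numDomainType) n : n`!%:R != 0 :> R.
Proof. by rewrite pnatr_eq0 -lt0n fact_gt0. Qed.

(** Side conditions of [field]: factorials, or linear expressions that [lra] proves positive from
    the [ler0n] facts introduced beforehand. *)
Ltac solve_neq0 :=
  repeat (apply/andP; split);
  first [exact: natr_fact_neq0 | apply: lt0r_neq0; lra].

Section TypeB.

Variable R : realType.

Local Notation typeB l := (skew_growth_formula R (TypeB l)).
Local Notation typeB_coef l k := ('C(l, k) * 'C(l + k - 1, k))%N.

(** Writing the upper index as a sum avoids truncated subtraction; in the coefficient lemmas [j]
    stands for the degree minus [k]. *)
Lemma natr_bin k j : 'C(k + j, k)%:R = (k + j)`!%:R / (k`!%:R * j`!%:R) :> R.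
Proof.
have := bin_fact (leq_addr j k); rewrite addKn => <-.
by rewrite !natrM mulfK // mulf_neq0 ?natr_fact_neq0.
Qed.

Lemma typeB_coef_small l k : (l < k)%N -> typeB_coef l k = 0%N.
Proof. by move=> lt_lk; rewrite bin_small. Qed.

Lemma coef_typeB l k : (typeB l)`_k = (-1) ^+ k * (typeB_coef l k)%:R.
Proof.
have -> : typeB l = \poly_(k < l.+1) ((-1) ^+ k * (typeB_coef l k)%:R).
  by rewrite poly_def.
rewrite coef_poly.
by case: ltnP => // lt_lk; rewrite typeB_coef_small // mulr0.
Qed.

Lemma typeB_coef_fact n k j : (k + j = n.+1)%N ->
  (typeB_coef n.+1 k)%:R = n.+1%:R * (n + k)`!%:R / (k`!%:R ^+ 2 * j`!%:R) :> R.
Proof.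
move=> nE; rewrite natrM addSn subn1 /= -{1}nE [(n + k)%N]addnC !natr_bin nE.
rewrite factS natrM; field; solve_neq0.
Qed.

(** Over the common factor [X] the recurrence becomes an identity of rational functions. The factors
    j and j - 1 vanish exactly where a lower degree is exceeded, so these cases need no separate
    treatment later. *)
Lemma typeB_coef_rec n k j (X : R) : (k + j = n.+3)%N ->
    X = (n + k)`!%:R / (k`!%:R ^+ 2 * j`!%:R) ->
  [/\ (typeB_coef n.+3 k)%:R = n.+3%:R * (n + k).+2%:R * (n + k).+1%:R * X,
      (typeB_coef n.+2 k)%:R = n.+2%:R * (n + k).+1%:R * j%:R * X &
      (typeB_coef n.+1 k)%:R = n.+1%:R * j%:R * (j%:R - 1) * X].
Proof.
move=> nE ->; split.
- rewrite (typeB_coef_fact nE) 2!addSn 2!factS !natrM.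
  field; solve_neq0.
- case: j nE => [|j] nE.
    by rewrite typeB_coef_small ?mulr0 ?mul0r // -(addn0 k) nE.
  have nE' : (k + j = n.+2)%N by lia.
  rewrite (typeB_coef_fact nE') addSn !factS !natrM.
  have j0 := ler0n R j; field; solve_neq0.
- case: j nE => [|[|j]] nE.
  + by rewrite typeB_coef_small ?mulr0 ?mul0r // -(addn0 k) nE.
  + by rewrite typeB_coef_small ?subrr ?mulr0 ?mul0r //; lia.
  have nE' : (k + j = n.+1)%N by lia.
  rewrite (typeB_coef_fact nE') !factS !natrM.
  have j0 := ler0n R j; field; solve_neq0.
Qed.

(** The term [v *: 'X] shifts the index, so the preceding coefficient is also needed over the factor
    [X] belonging to [k.+1]. *)
Lemma typeB_coef_pred n k j (X : R) : (k.+1 + j = n.+3)%N ->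
    X = (n + k.+1)`!%:R / (k.+1`!%:R ^+ 2 * j`!%:R) ->
  (typeB_coef n.+2 k)%:R = n.+2%:R * k.+1%:R ^+ 2 * X.
Proof.
move=> nE ->; have nE' : (k + j = n.+2)%N by lia.
rewrite (typeB_coef_fact nE') addSnnS factS !natrM.
have k0 := ler0n R k; field; solve_neq0.
Qed.

(* The three-term recurrence of the Jacobi polynomials P_n^(0,1) on [0, 1]. *)
Definition jacobi_v n : R := 2 * (2 * n%:R + 5) / (n%:R + 3).
Definition jacobi_w n : R :=
  (2 * n%:R + 5) * (n%:R + 1) / ((n%:R + 3) * (2 * n%:R + 3)).

Definition three_term (v w : R) (p q : {poly R}) :=
  ((1 + w)%:P - v *: 'X) * p - w *: q.

Lemma coef_three_term v w p q k :
  (three_term v w p q)`_k =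
  (1 + w) * p`_k - v * (if k is j.+1 then p`_j else 0) - w * q`_k.
Proof.
rewrite /three_term mulrBl !coefB mul_polyC -scalerAl !coefZ coefXM.
by case: k.
Qed.

Lemma horner_three_term v w p q (x : R) :
  (three_term v w p q).[x] = (1 + w - v * x) * p.[x] - w * q.[x].
Proof. by rewrite /three_term !hornerE. Qed.

Lemma three_term_mull v w r p q :
  three_term v w (r * p) (r * q) = r * three_term v w p q.
Proof. by rewrite /three_term mulrBr mulrCA scalerAr. Qed.

Lemma typeB_rec n :
  typeB n.+3 = three_term (jacobi_v n) (jacobi_w n) (typeB n.+2) (typeB n.+1).
Proof.
apply/polyP => k; rewrite coef_three_term !coef_typeB.
case: (leqP k n.+3) => [le_k|lt_k]; last first.
  rewrite !typeB_coef_small; try lia.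
  case: k lt_k => // k lt_k; rewrite coef_typeB typeB_coef_small; last by lia.
  by rewrite !mulr0 !subr0.
have nE := subnKC le_k; move: (n.+3 - k)%N nE => j nE.
have [-> -> ->] := typeB_coef_rec nE erefl.
have jE : j%:R = n%:R + 3 - k%:R :> R.
  by rewrite -[3]/(3%:R) -natrD addn3 -nE natrD addrAC subrr add0r.
have n0 := ler0n R n.
rewrite /jacobi_v /jacobi_w.
case: k nE jE {le_k} => [|k] nE jE.
  by rewrite jE; field; solve_neq0.
rewrite coef_typeB (typeB_coef_pred nE erefl) exprS jE.
have k0 := ler0n R k; field; solve_neq0.
Qed.

(** Carrying two consecutive polynomials makes the two-step recurrence structural. The initial ones
    are the cofactors of 1 - t in the type B formulas for l = 1 and l = 2. *)
Fixpoint jacobi_pair n : {poly R} * {poly R} :=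
  if n is m.+1 then
    let: (p, q) := jacobi_pair m in
    (q, three_term (jacobi_v m) (jacobi_w m) q p)
  else (1, 1 - 3 *: 'X).

Definition jacobi n := (jacobi_pair n).1.

Lemma jacobiSS n :
  jacobi n.+2 = three_term (jacobi_v n) (jacobi_w n) (jacobi n.+1) (jacobi n).
Proof. by rewrite /jacobi /=; case: jacobi_pair. Qed.

(** [Q] takes the polynomial as an argument so that base cases and step show it explicitly. *)
Lemma jacobi_ind (Q : nat -> {poly R} -> Prop) :
    Q 0%N 1 -> Q 1%N (1 - 3 *: 'X) ->
    (forall n, Q n (jacobi n) -> Q n.+1 (jacobi n.+1) ->
       Q n.+2
         (three_term (jacobi_v n) (jacobi_w n) (jacobi n.+1) (jacobi n))) ->
  forall n, Q n (jacobi n).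
Proof.
move=> Q0 Q1 QS n; suff [] : Q n (jacobi n) /\ Q n.+1 (jacobi n.+1) by [].
by elim: n => [|n [Qn QSn]]; split=> //; rewrite jacobiSS; apply: QS.
Qed.

Lemma jacobi_w_gt0 n : 0 < jacobi_w n.
Proof. by have n0 := ler0n R n; rewrite divr_gt0 ?mulr_gt0 //; lra. Qed.

Lemma horner_jacobi0 n : (jacobi n).[0] = 1.
Proof.
apply: (@jacobi_ind (fun _ p => p.[0] = 1)) => [||{}n IH0 IH1].
- by rewrite hornerE.
- by rewrite !hornerE /= subr0.
- by rewrite horner_three_term IH0 IH1; ring.
Qed.

(** With the value at 0, this supplies the end signs for the Sturm steps and for type D. *)
Lemma horner_jacobi1 n : (jacobi n).[1] = (-1) ^+ n * n.+1%:R.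
Proof.
apply: (@jacobi_ind (fun n p => p.[1] = (-1) ^+ n * n.+1%:R)) =>
  [||{}n IH0 IH1].
- by rewrite hornerE mulr1.
- by rewrite !hornerE /=; ring.
rewrite horner_three_term IH0 IH1 /jacobi_w /jacobi_v !exprS.
have n0 := ler0n R n; field; solve_neq0.
Qed.

Lemma size_jacobi n : (size (jacobi n) <= n.+1)%N.
Proof.
apply: (@jacobi_ind (fun n p => (size p <= n.+1)%N)) => [||{}n IH0 IH1].
- by rewrite size_poly1.
- apply/leq_sizeP => -[|[|j]] // _.
  by rewrite coefB coef1 coefZ coefX mulr0 subr0.
- apply/leq_sizeP => -[//|j] lt_j; rewrite coef_three_term.
  move/leq_sizeP: IH0 => IH0; move/leq_sizeP: IH1 => IH1.
  by rewrite IH0 ?(IH1 j) ?IH1 ?mulr0 ?subr0 //; lia.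
Qed.

(** Both sides obey the same three-term recurrence, so only the first two cases are computed. *)
Lemma typeB_factor n : typeB n.+1 = (1 - 'X) * jacobi n.
Proof.
apply: (@jacobi_ind (fun n p => typeB n.+1 = (1 - 'X) * p)) => [||{}n IH0 IH1].
- rewrite [RHS]mulr1; apply/polyP => -[|[|k]]; rewrite coef_typeB !coefE //=.
  + by rewrite /binomial /=; ring.
  + by rewrite /binomial /=; ring.
  + by rewrite typeB_coef_small // mulr0 subr0.
- have -> : (1 - 'X) * (1 - 3 *: 'X) = 1 - 4 *: 'X + 3 *: 'X^2 :> {poly R}.
    rewrite -!mul_polyC; ring.
  apply/polyP => -[|[|[|k]]]; rewrite coef_typeB !coefE //=.
  + by rewrite /binomial /=; ring.
  + by rewrite /binomial /=; ring.
  + by rewrite /binomial /=; ring.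
  + by rewrite typeB_coef_small // !mulr0 subr0 addr0.
- by rewrite typeB_rec IH0 IH1 three_term_mull.
Qed.

(** At a root of [p] only the term -w q survives. Leaving [v] and [w] general serves both the Jacobi
    recurrence and type D. *)
Lemma three_term_nodes_lt0 v w p q n r : 0 < w -> sturm_nodes p q n r ->
  forall i, (i < n)%N -> (three_term v w p q).[r i.+1] * q.[r i.+1] < 0.
Proof.
move=> w0 [_ _ _ rP] i /rP[/rootP pr qr].
rewrite horner_three_term pr mulr0 sub0r mulNr oppr_lt0.
rewrite -mulrA pmulr_rgt0 // -expr2 exprn_even_gt0 //=.
by apply: contraTneq qr => ->; rewrite mulr0 ltxx.
Qed.

Lemma jacobi_sturm_nodes n :
  exists r, sturm_nodes (jacobi n.+1) (jacobi n) n.+1 r.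
Proof.
elim: n => [|n [r nodes]].
(* No interior node yet: [i%:R] gives the two end nodes 0 and 1, and the condition at the roots is
   vacuous. *)
- have nodes : sturm_nodes (jacobi 0) (jacobi 0) 0 (fun i => i%:R).
    by split=> // i _; rewrite ltr_nat.
  apply: (sturm_nodes_step nodes); rewrite ?horner_jacobi0 ?size_jacobi //.
  by rewrite horner_jacobi1 expr1 mulrA mulrNN mul1r mul1r ltr0n.
- apply: (sturm_nodes_step nodes); rewrite ?horner_jacobi0 ?size_jacobi //.
    by rewrite horner_jacobi1 mulrA -expr2 sqrr_sign mul1r ltr0n.
  by rewrite jacobiSS; apply: three_term_nodes_lt0 (jacobi_w_gt0 n) nodes.
Qed.

End TypeB.

(** * The infinite families *)

Section RootsOfFormulas.

Variable R : realType.

Local Notation formula P := (skew_growth_formula R P).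

Lemma coef_typeA l k : (formula (TypeA l))`_k =
  (-1) ^+ k * (l%:R^-1 * ('C(l, k) * 'C(l + k, k.+1))%:R).
Proof.
have -> : formula (TypeA l) = \poly_(k < l.+1)
    ((-1) ^+ k * (l%:R^-1 * ('C(l, k) * 'C(l + k, k.+1))%:R)).
  by rewrite poly_def.
by rewrite coef_poly; case: ltnP => // lt_lk; rewrite bin_small // mul0n !mulr0.
Qed.

(** Stated with the type B formulas rather than the Jacobi polynomials because their coefficients
    have closed forms to compare. *)
Lemma typeA_typeB n :
  (2 * n%:R + 3) *: ('X * formula (TypeA n.+1)) =
  formula (TypeB n.+1) - formula (TypeB n.+2).
Proof.
apply/polyP => -[|k]; rewrite coefZ coefXM coefB !coef_typeB.
  by rewrite /= !bin0 mulr0 subrr.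
rewrite coef_typeA /=; case: (leqP k n.+1) => [le_k|lt_k]; last first.
  by rewrite !typeB_coef_small 1?(@bin_small n.+1) ?mul0n ?mulr0 ?subrr //; lia.
have nE := subnKC le_k; move: (n.+1 - k)%N nE => j nE.
have nE' : (k.+1 + j = n.+2)%N by rewrite addSn nE.
have binE : 'C(n.+1, k)%:R = n.+1`!%:R / (k`!%:R * j`!%:R) :> R.
  by rewrite -nE natr_bin.
have binE' : 'C(n.+1 + k, k.+1)%:R =
    (n.+1 + k)`!%:R / (k.+1`!%:R * n`!%:R) :> R.
  have -> : (n.+1 + k = k.+1 + n)%N by lia.
  by rewrite natr_bin.
have jE : j%:R = n%:R + 1 - k%:R :> R.
  by rewrite natr1 -nE natrD addrAC subrr add0r.
have n0 := ler0n R n; have k0 := ler0n R k.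
rewrite (typeB_coef_fact _ nE').
have -> : ('C(n.+1, k.+1) * 'C(n.+1 + k.+1 - 1, k.+1))%:R =
    n.+1%:R * j%:R * (n.+1 + k)`!%:R / (k.+1`!%:R ^+ 2 * j`!%:R) :> R.
  (* For [j = 0] the index [k.+1] exceeds the degree, in agreement with the factor [j%:R]. *)
  case: j nE {nE' binE jE} => [|j] nE.
    by rewrite bin_small ?mul0n ?mulr0 ?mul0r // -(addn0 k) nE.
  have nE' : (k.+1 + j = n.+1)%N by rewrite addSnnS.
  rewrite (typeB_coef_fact _ nE') addnS [j.+1`!]factS natrM.
  have j0 := ler0n R j; field; solve_neq0.
rewrite natrM binE binE' addnS.
rewrite [(n.+1 + k).+1`!]factS [k.+1`!]factS [n.+1`!]factS.
rewrite !natrM jE exprS.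
field; solve_neq0.
Qed.

(** At the roots of [jacobi R n.+1] the cofactor [e] equals [jacobi R n], hence alternates: these n
    + 1 points enclose n roots, and 1 is the last one. *)
Lemma typeA_roots n : has_simple_roots01 (formula (TypeA n.+1)) n.+1.
Proof.
have [r nodes] := jacobi_sturm_nodes R n.
have [r0 r1 _ rP] := nodes; have r_lt := sturm_nodes_lt nodes.
pose e : {poly R} := jacobi R n - jacobi R n.+1.
have n0 := ler0n R n.
have AE x : (2 * n%:R + 3) * (x * (formula (TypeA n.+1)).[x]) = (1 - x) * e.[x].
  have := congr1 (fun p => p.[x]) (typeA_typeB n).
  by rewrite !typeB_factor -mulrBr hornerZ !hornerM !hornerE.
have rootA x : 0 < x -> (1 - x) * e.[x] = 0 -> root (formula (TypeA n.+1)) x.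
  move=> x0 /eqP; rewrite -AE !mulf_eq0 (gt_eqF x0) /= => /orP[/eqP|//]; lra.
have ex i : (i <= n)%N -> 0 < (-1) ^+ i * e.[r i.+1].
  by move=> /rP[/rootP pr]; rewrite /e hornerD hornerN pr subr0.
(* The shift [r \o S] drops the node 0, where [e] vanishes. *)
have [i lt_in|y yP] := alternating_roots (x := r \o S) _ ex.
  by rewrite /= r_lt //; lia.
have r1_gt0 : 0 < r 1%N by rewrite -r0 r_lt.
apply: (interior_nodes_roots (x := r \o S) (y := y)).
- apply: contra_eqN (coef_typeA n.+1 0) => /eqP->.
  rewrite coef0 mul1r bin0 mul1n addn0 bin1 mulVf ?pnatr_eq0 //.
  by rewrite eq_sym oner_eq0.
- by apply/leq_sizeP => j lt_j; rewrite coef_typeA bin_small // mul0n !mulr0.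
- by apply: rootA; rewrite ?subrr ?mul0r.
- exact: ltW.
- by rewrite /= -r1; apply/ltW/r_lt; lia.
- by move=> i lt_in; rewrite /= r_lt //; lia.
- move=> i lt_in; have [/[dup] yi -> /rootP ey] := yP i lt_in; split=> //.
  apply: rootA; last by rewrite ey mulr0.
  case/andP: yi => + _; apply: le_lt_trans; rewrite -r0 /=.
  by apply/ltW/r_lt; lia.
Qed.

(** The interior nodes are themselves the roots other than 1. *)
Lemma typeB_roots n : has_simple_roots01 (formula (TypeB n.+2)) n.+2.
Proof.
have [r nodes] := jacobi_sturm_nodes R n.
have [r0 r1 _ rP] := nodes; have r_lt := sturm_nodes_lt nodes.
apply: (interior_roots_in01 (y := r \o S)).
- apply: contra_eqN (coef_typeB R n.+2 0) => /eqP->.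
  by rewrite coef0 mul1r !bin0 eq_sym oner_eq0.
- by apply/leq_sizeP => j lt_j; rewrite coef_typeB typeB_coef_small // mulr0.
- by rewrite typeB_factor rootM /root !hornerE subrr eqxx.
- move=> i lt_in; split; last by rewrite typeB_factor rootM (rP i lt_in).1 orbT.
  by rewrite /= -{1}r0 -r1 !r_lt //; lia.
- by move=> i lt_in; rewrite /= r_lt //; lia.
Qed.

(** The coefficients for which [typeD_typeB] holds; they differ from [jacobi_v] and [jacobi_w]. *)
Definition typeD_v n : R := (3 * n%:R + 5) / (n%:R + 3).
Definition typeD_w n : R := (n%:R + 1) ^+ 2 / ((n%:R + 3) * (2 * n%:R + 3)).

Local Notation typeD_coef l k :=
  ('C(l, k) * 'C(l + k - 2, k) +
   (if (2 <= k)%N then 'C(l - 2, k - 2) * 'C(l + k - 3, k) else 0))%N.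

Lemma coef_typeD n k : 
  (formula (TypeD n.+3))`_k = (-1) ^+ k * (typeD_coef n.+3 k)%:R.
Proof.
have -> : formula (TypeD n.+3) =
    \poly_(k < n.+4) ((-1) ^+ k * (typeD_coef n.+3 k)%:R).
  by rewrite poly_def.
rewrite coef_poly; case: ltnP => // lt_nk.
by rewrite (@bin_small n.+3) ?(@bin_small (n.+3 - 2)) ?if_same ?mulr0 //; lia.
Qed.

(** Both summands share the factorial quotient of [typeB_coef_rec]. The factor k (k - 1) vanishes
    for k < 2 and so absorbs the conditional. *)
Lemma typeD_coef_fact n k j : (k + j = n.+3)%N ->
  (typeD_coef n.+3 k)%:R =
  (n.+3%:R * n.+2%:R * (n + k).+1%:R + n.+1%:R * k%:R * (k%:R - 1)) *
  ((n + k)`!%:R / (k`!%:R ^+ 2 * j`!%:R)) :> R.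
Proof.
move=> nE.
have n0 := ler0n R n.
rewrite natrD natrM mulrDl; congr (_ + _).
  have -> : (n.+3 + k - 2 = k + n.+1)%N by lia.
  rewrite -{1}nE !natr_bin nE addnS [(k + n)%N]addnC.
  rewrite [n.+3`!]factS [n.+2`!]factS [(n + k).+1`!]factS !natrM.
  field; solve_neq0.
case: k nE => [|[|k]] nE; rewrite ?mulr0 ?subrr ?mulr0 ?mul0r //=.
have k0 := ler0n R k.
have -> : (n.+3 - 2 = k + j)%N by lia.
have -> : (k.+2 - 2 = k)%N by lia.
have -> : (n.+3 + k.+2 - 3 = k.+2 + n)%N by lia.
have nE' : (k + j = n.+1)%N by lia.
rewrite natrM !natr_bin nE' [(k.+2 + n)%N]addnC [k.+2`!]factS [k.+1`!]factS.
rewrite [n.+1`!]factS !natrM; field; solve_neq0.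
Qed.

Lemma typeD_typeB n : formula (TypeD n.+3) =
  three_term (typeD_v n) (typeD_w n)
    (formula (TypeB n.+2)) (formula (TypeB n.+1)).
Proof.
apply/polyP => k; rewrite coef_three_term !coef_typeB coef_typeD.
case: (leqP k n.+3) => [le_k|lt_k]; last first.
  rewrite (@bin_small n.+3 k) ?(@bin_small (n.+3 - 2)) ?if_same; try lia.
  rewrite !typeB_coef_small; try lia.
  case: k lt_k => // k lt_k; rewrite coef_typeB typeB_coef_small; last by lia.
  by rewrite !mulr0 !subr0.
have nE := subnKC le_k; move: (n.+3 - k)%N nE => j nE.
rewrite (typeD_coef_fact nE).
have [_ -> ->] := typeB_coef_rec nE (erefl (_ : R)).
have jE : j%:R = n%:R + 3 - k%:R :> R.
  by rewrite -[3]/(3%:R) -natrD addn3 -nE natrD addrAC subrr add0r.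
have n0 := ler0n R n; have k0 := ler0n R k.
rewrite /typeD_v /typeD_w.
case: k nE jE {le_k} k0 => [|k] nE jE k0.
  rewrite jE; field; solve_neq0.
rewrite coef_typeB (typeB_coef_pred nE erefl) exprS jE; field; solve_neq0.
Qed.

(** The cofactor [e] alternates along all n + 3 nodes, ends included, so each of the n + 2 gaps
    contains a root. *)
Lemma typeD_roots n : has_simple_roots01 (formula (TypeD n.+3)) n.+3.
Proof.
have [r nodes] := jacobi_sturm_nodes R n.
have [r0 r1 r_lt rP] := nodes.
have n0 := ler0n R n.
pose e : {poly R} :=
  three_term (typeD_v n) (typeD_w n) (jacobi R n.+1) (jacobi R n).
have DE : formula (TypeD n.+3) = (1 - 'X) * e.
  by rewrite typeD_typeB !typeB_factor three_term_mull.
have w0 : 0 < typeD_w n.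
  by rewrite divr_gt0 ?exprn_gt0 ?mulr_gt0 //; lra.
have e0 : e.[0] = 1.
  by rewrite horner_three_term !horner_jacobi0; ring.
have e1 : e.[1] = (-1) ^+ n * (n%:R + 1).
  rewrite horner_three_term !horner_jacobi1 exprS /typeD_v /typeD_w.
  field; solve_neq0.
have [|||y yP] := sturm_nodes_alternating nodes (f := e).
- by rewrite e0.
- by rewrite e1 mulrA !exprS !mulN1r opprK -expr2 sqrr_sign mul1r; lra.
- exact: three_term_nodes_lt0 w0 nodes.
apply: (interior_nodes_roots (x := r) (y := y)); rewrite ?r0 ?r1 //.
- apply: contra_eqN (coef_typeD n 0) => /eqP->.
  by rewrite coef0 mul1r !bin0 eq_sym oner_eq0.
- apply/leq_sizeP => j lt_j; rewrite coef_typeD.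
  by rewrite (@bin_small n.+3) ?(@bin_small (n.+3 - 2)) ?if_same ?mulr0 //; lia.
- by rewrite DE rootM /root !hornerE subrr eqxx.
- by move=> i /yP[-> ey]; rewrite DE rootM ey orbT.
Qed.

End RootsOfFormulas.

(** * The exceptional and dihedral types *)

Section ExceptionalTypes.

Variable R : realType.

Local Notation formula P := (skew_growth_formula R P).

Lemma alternating_nodes_roots (f : {poly R}) (xs : seq R) n :
    (size f <= n.+2)%N -> root f 1 ->
    0 <= xs`_0 -> xs`_n <= 1 ->
    (forall i, (i < n)%N -> xs`_i < xs`_i.+1) ->
    (forall i, (i <= n)%N -> 0 < (-1) ^+ i * f.[xs`_i]) ->
  has_simple_roots01 f n.+1.
Proof.
move=> sf f1 x0 xn x_lt fx; have [y yP] := alternating_roots x_lt fx.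
apply: interior_nodes_roots yP => //.
(* A strict sign at the first node already shows [f] nonzero. *)
by apply: contraTneq (fx 0%N isT) => ->; rewrite horner0 mulr0 ltxx.
Qed.

(* [lra] overflows the stack on the larger unary coefficients. *)
Lemma natr_thousands (n a b : nat) :
  (n == a * 1000 + b)%N -> n%:R = a%:R * 1000 + b%:R :> R.
Proof. by move=> /eqP ->; rewrite natrD natrM. Qed.

Ltac split_thousands n a b :=
  rewrite (@natr_thousands n a b); last by vm_compute.

(** Enumerates the values of a bounded index; [//] ends the recursion once the bound fails. *)
Ltac case_indices :=
  repeat match goal with |- forall _ : nat, _ => case=> // end.

(** [xs] has as many points as the rank, starting at 0. Each gap between neighbours shows a sign
    change, and 1 is the remaining root. *)
Ltac check_nodes xs :=
  apply: (@alternating_nodes_roots _ xs);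
  [ exact: size_Poly
  | rewrite /root horner_Poly /=; apply/eqP; lra
  | rewrite /=; lra
  | rewrite /=; lra
  | case_indices; rewrite /= => *; lra
  | case_indices; move=> _;
    rewrite ?exprS expr0 horner_Poly /=; lra].

Lemma typeH3_roots : has_simple_roots01 (formula TypeH3) 3.
Proof.
rewrite /skew_growth_formula.
check_nodes ([:: 0; 1 / 3; 2 / 3] : seq R).
Qed.

Lemma typeF4_roots : has_simple_roots01 (formula TypeF4) 4.
Proof.
rewrite /skew_growth_formula.
check_nodes ([:: 0; 1 / 4; 1 / 2; 3 / 4] : seq R).
Qed.

Lemma typeH4_roots : has_simple_roots01 (formula TypeH4) 4.
Proof.
rewrite /skew_growth_formula.
check_nodes ([:: 0; 1 / 4; 1 / 2; 3 / 4] : seq R).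
Qed.

Lemma typeE6_roots : has_simple_roots01 (formula TypeE6) 6.
Proof.
rewrite /skew_growth_formula.
split_thousands 1035%N 1%N 35%N.
split_thousands 1720%N 1%N 720%N.
split_thousands 1368%N 1%N 368%N.
check_nodes ([:: 0; 1 / 8; 1 / 4; 1 / 2; 3 / 4; 7 / 8] : seq R).
Qed.

Lemma typeE7_roots : has_simple_roots01 (formula TypeE7) 7.
Proof.
rewrite /skew_growth_formula.
split_thousands 3927%N 3%N 927%N.
split_thousands 9933%N 9%N 933%N.
split_thousands 13299%N 13%N 299%N.
split_thousands 9009%N 9%N 9%N.
split_thousands 2431%N 2%N 431%N.
check_nodes ([:: 0; 1 / 10; 1 / 5; 2 / 5; 3 / 5; 4 / 5; 9 / 10] : seq R).
Qed.

Lemma typeE8_roots : has_simple_roots01 (formula TypeE8) 8.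
Proof.
rewrite /skew_growth_formula.
split_thousands 2135%N 2%N 135%N.
split_thousands 15120%N 15%N 120%N.
split_thousands 54327%N 54%N 327%N.
split_thousands 108360%N 108%N 360%N.
split_thousands 121555%N 121%N 555%N.
split_thousands 71760%N 71%N 760%N.
split_thousands 17342%N 17%N 342%N.
check_nodes
  ([:: 0; 1 / 13; 2 / 13; 4 / 13; 6 / 13; 9 / 13; 11 / 13; 12 / 13] : seq R).
Qed.

Lemma typeI2_roots p : (2 < p)%N -> has_simple_roots01 (formula (TypeI2 p)) 2.
Proof.
(* From here [p] is the former p - 1: the polynomial is (1 - t)(1 - p t), with interior root 1/p. *)
case: p => [//|p] p_gt1; rewrite ltnS in p_gt1.
have p1 : 1 < p%:R :> R by rewrite ltr1n.
have fE x : (formula (TypeI2 p.+1)).[x] = (1 - x) * (1 - p%:R * x).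
  by rewrite /skew_growth_formula horner_Poly /= subn1 -natr1 /=; ring.
apply: (@interior_roots_in01 _ _ (fun=> p%:R^-1)).
- apply: contra_eqN (fE 0) => /eqP->.
  by rewrite horner0 !mulr0 !subr0 mul1r eq_sym oner_eq0.
- exact: size_Poly.
- by rewrite /root fE subrr mul0r.
- move=> i _; split; first by rewrite invr_gt0 invf_lt1 //; lra.
  by rewrite /root fE mulfV ?subrr ?mulr0 //; apply: lt0r_neq0; lra.
- by case.
Qed.

Lemma skew_growth_formula_roots P :
  finite_type P -> has_simple_roots01 (formula P) (rank P).
Proof.
case: P => [[//|l]|[|[//|l]]|[|[|[//|l]]]||||||||p] //= fin.
- exact: typeA_roots.
- exact: typeB_roots.
- exact: typeD_roots.
- exact: typeE6_roots.
- exact: typeE7_roots.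
- exact: typeE8_roots.
- exact: typeF4_roots.
(* The formulas of G_2 and I_2(6) agree by conversion. *)
- exact: (@typeI2_roots 6).
- exact: typeH3_roots.
- exact: typeH4_roots.
- exact: typeI2_roots.
Qed.

End ExceptionalTypes.

Theorem theorem4p1 (R : realType) (P : coxeter_type) (gT : finGroupType)
    (s : 'I_(rank P) -> gT) (I : {set 'I_(rank P)})
    (P_finite : finite_type P)
    (s_coxeter : coxeter_system s)
    (I_bipartition : bipartition I)
    (known_formula :
       skew_growth s R (coxeter_element s I) = skew_growth_formula R P) :
  exists rs : seq R,
    [/\ uniq rs, size rs = rank P,
        (forall x : R, (x \in rs) =
           ((0 < x <= 1) && root (skew_growth s R (coxeter_element s I)) x)),
        (forall x : R, x \in rs ->
           mup x (skew_growth s R (coxeter_element s I)) = 1%N) &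
        1 \in rs].
Proof. by rewrite known_formula; apply: skew_growth_formula_roots. Qed.
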